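(* Let $G=(V,E)$ be an AT-free graph (finite, simple, connected, with no isolated vertices) and let $(x,y)$ be a dominating pair of $G$. For $0\le k\le l$ let $L_k=\{w\in V : d_G(x,w)=k\}$ be the BFS-levels of a BFS-tree of $G$ rooted at $x$, where $l$ is the largest distance from $x$. Then there exists a minimum cardinality paired dominating set $D_p$ of $G$ such that $\left| D_p \cap \bigcup_{k=i}^{i+j} L_k \right| \le j+4$ for all $i\in\{0,1,\ldots,l\}$ and all $j\in\{0,1,\ldots,l-i\}$.
   Context: For a graph $G=(V,E)$, a set $D\subseteq V$ is dominating if every vertex of $V\setminus D$ has a neighbour in $D$. For a graph with no isolated vertices, a paired dominating set is a dominating set $D$ such that $G[D]$ has a perfect matching. Three pairwise non-adjacent vertices form an asteroidal triple if for any two of them there is a path between them avoiding the closed neighbourhood of the third; a graph is AT-free if it has no asteroidal triple. A pair of vertices $(x,y)$ is a dominating pair if the vertex set of every path between $x$ and $y$ in $G$ is a dominating set of $G$. $d_G(x,w)$ denotes the length of a shortest $x$–$w$ path. *)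

(* Defs.v *)
From mathcomp Require Import all_boot.

Set Implicit Arguments.
Unset Strict Implicit.
Unset Printing Implicit Defensive.

(* A finite simple graph is a symmetric irreflexive
   adjacency relation e : rel T on a finType T of vertices. *)

Section Graph.
Variables (T : finType) (e : rel T).
Implicit Types (x y u v w : T) (p : seq T) (D : {set T}).

(* As in path.v, the path consists of the vertices x :: p; vertices are not
   repeated, and size p is the number of edges. *)
Definition gpath x y p := [&& path e x p, last x p == y & uniq (x :: p)].

Definition connected_graph := forall u v, connect e u v.

Definition no_isolated := forall v, exists u, e v u.

Definition dominating D := forall v, v \notin D -> exists2 u, u \in D & e v u.

(* A matching is a set M of edges, an edge being an unordered pair [set u; v]
   of adjacent vertices; M is perfect on D when its edges partition D. *)
Definition perfect_matching D (M : {set {set T}}) :=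
  partition M D /\
  forall B, B \in M -> exists u v, e u v /\ B = [set u; v].

Definition paired_dominating D :=
  dominating D /\ exists M, perfect_matching D M.

Definition min_paired_dominating D :=
  paired_dominating D /\ forall D', paired_dominating D' -> #|D| <= #|D'|.

Definition closed_nbhd v : {set T} := [set w | (w == v) || e v w].

Definition linked_avoiding u v w :=
  exists2 p, gpath u v p & forall z, z \in u :: p -> z \notin closed_nbhd w.

Definition asteroidal_triple a b c :=
  [/\ uniq [:: a; b; c],
      [/\ ~~ e a b, ~~ e b c & ~~ e a c],
      linked_avoiding a b c,
      linked_avoiding b c a &
      linked_avoiding a c b].

Definition AT_free := forall a b c, ~ asteroidal_triple a b c.

Definition dominating_pair x y :=
  forall p, gpath x y p -> dominating [set z in x :: p].

(* The least n < #|T| such that some path from x to w has n edges, or #|T| if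
   there is no path at all; see gdist_shortest. *)
Definition gdist x w : nat :=
  find (fun n => [exists p : n.-tuple T, gpath x w p]) (iota 0 #|T|).

Definition level x k : {set T} := [set w | gdist x w == k].

Definition ecc x : nat := \max_w gdist x w.

Lemma gdist_shortest x w : connect e x w ->
  (exists2 p, gpath x w p & size p = gdist x w) /\
  (forall p, gpath x w p -> gdist x w <= size p).
Proof.
move=> cxw; rewrite /gdist; set P := fun n : nat => _.
have sizeP p : gpath x w p -> P (size p) /\ size p < #|T|.
  move=> gp; split; first by apply/existsP; exists (in_tuple p).
  have /and3P[_ _ up] := gp.
  by rewrite -[(size p).+1]/(size (x :: p)) -(card_uniqP up) max_card.
have hasP' : has P (iota 0 #|T|).
  have [q gq] : exists q, gpath x w q.
    case/connectP: cxw => q eq ->; case/shortenP: eq => q' pq' uq' _.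
    by exists q'; rewrite /gpath pq' eqxx.
  have [Pq ltq] := sizeP q gq.
  by apply/hasP; exists (size q); rewrite // mem_iota.
have ltf : find P (iota 0 #|T|) < #|T|.
  by move: hasP'; rewrite has_find size_iota.
split.
  have := nth_find 0 hasP'; rewrite nth_iota // add0n => /existsP[p gp].
  by exists p => //; rewrite size_tuple.
move=> p /sizeP[Pp ltp]; rewrite leqNgt; apply/negP => lt_pf.
by have := before_find 0 lt_pf; rewrite nth_iota // add0n Pp.
Qed.

End Graph.

(* Main.v *)
(* Let d = dist x y. Going down from y and always choosing a neighbour with as
   few neighbours one level below as possible, one gets a shortest path
   c 0 = x, ..., c d = y such that every z at level k is equal or adjacent to
   c k or c (k - 1): a z at level k adjacent only to c (k + 1) would have
   fewer such neighbours than c k, for otherwise x, c k and z are an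
   asteroidal triple.

   Among the minimum paired dominating sets let D have the largest
   intersection with this path. Suppose that j + 1 consecutive levels starting
   from level i contain at least j + 5 vertices of D, with j as large as
   possible. Then D misses the levels i - 1 and i + j + 1, so its matching
   restricts to the part of D outside these levels, and the at most j + 4
   vertices c (i - 2), ..., c (i + j + 1) dominate all that the removed part
   dominated. Replacing that part by them, plus one more vertex if their number
   is odd, gives a paired dominating set that is either smaller than D, or of
   the same size but with more vertices on the path. *)
Require Import Defs.
From mathcomp Require Import all_boot.
From mathcomp Require Import zify.

Set Implicit Arguments.
Unset Strict Implicit.
Unset Printing Implicit Defensive.

(** * Matchable sets and extremal paired dominating sets *)

Section Matching.
Variables (T : finType) (e : rel T).
Hypotheses (e_sym : symmetric e) (e_irr : irreflexive e)
  (e_noiso : no_isolated e).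
Implicit Types (u v w : T) (D S : {set T}).

Definition matchable D := exists M, perfect_matching e D M.

Lemma matchable0 : matchable set0.
Proof.
exists set0; split; last by move=> B; rewrite inE.
by rewrite /partition /cover big_set0 eqxx inE andbT; apply/trivIsetP => A B; rewrite inE.
Qed.

Lemma matchableU2 S u v :
  matchable S -> u \notin S -> v \notin S -> e u v ->
  matchable ([set u; v] :|: S).
Proof.
move=> [M [partM edgeM]] uS vS euv; exists ([set u; v] |: M); split.
  apply: partitionU1 => //; first by apply/set0Pn; exists u; rewrite set21.
  by rewrite disjoints_subset; apply/subsetP => w /set2P[]->; rewrite inE.
by move=> B /setU1P[->|/edgeM//]; exists u, v.
Qed.

(** No edge joins [A] to a vertex of [D] outside [A], so a matching edge with one end outside [A]
    avoids [A] altogether; these edges match [D :\: A]. *)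
Lemma matchableD D (A : {set T}) :
  matchable D ->
  (forall u v, e u v -> u \in A -> v \in D -> v \in A) ->
  matchable (D :\: A).
Proof.
move=> [M [/and3P[/eqP covM trivM M0] edgeM]] Aclosed.
exists [set B in M | B \subset D :\: A].
have subM : [set B in M | B \subset D :\: A] \subset M.
  by apply/subsetP => B; rewrite inE => /andP[].
split; last by move=> B /(subsetP subM)/edgeM.
apply/and3P; split; last 1 first.
- by apply: contra M0 => /(subsetP subM).
- rewrite eqEsubset; apply/andP; split.
    by apply/bigcupsP => B; rewrite inE => /andP[].
  apply/subsetP => w /setDP[wD wA].
  have wM : w \in cover M by rewrite covM.
  have BM := pblock_mem wM.
  apply/bigcupP; exists (pblock M w); last by rewrite mem_pblock.
  rewrite inE BM /=; apply/subsetP => z zB.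
  have zD : z \in D by rewrite -covM; apply/bigcupP; exists (pblock M w).
  rewrite inE zD andbT; apply: contra wA => zA.
  have wB : w \in pblock M w by rewrite mem_pblock.
  have [u [v [euv defB]]] := edgeM _ BM.
  move: wB zB; rewrite defB => /set2P[] Ew /set2P[] Ez; first by rewrite Ew -Ez.
  - by apply: (Aclosed z) => //; rewrite Ew Ez e_sym.
  - by apply: (Aclosed z) => //; rewrite Ew Ez.
  by rewrite Ew -Ez.
exact: trivIsetS subM trivM.
Qed.

Definition segment (c : nat -> T) lo n := [set z in map c (iota lo n)].

Lemma segmentP c lo n z :
  reflect (exists2 k, lo <= k < lo + n & z = c k) (z \in segment c lo n).
Proof.
rewrite inE; apply: (iffP mapP) => -[k kP ->]; exists k => //;
by rewrite mem_iota in kP *.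
Qed.

Lemma card_segment_le c lo n : #|segment c lo n| <= n.
Proof.
by rewrite cardsE -[X in _ <= X](size_iota lo) -(size_map c) card_size.
Qed.

Lemma segmentSr c lo n : segment c lo n.+1 = c (lo + n) |: segment c lo n.
Proof.
by rewrite /segment -addn1 iotaD map_cat; apply/setP => z;
  rewrite !inE mem_cat inE orbC.
Qed.

(** The new vertices are paired consecutively along [c], starting with [c lo] and [c lo.+1]; hence
    the even length. *)
Lemma matchable_segment S c lo n :
  matchable S ->
  {in [pred k | lo <= k < lo + n.*2] &, injective c} ->
  (forall k, lo <= k < lo + n.*2 -> c k \notin S) ->
  (forall k, lo <= k -> k.+1 < lo + n.*2 -> e (c k) (c k.+1)) ->
  matchable (S :|: segment c lo n.*2).
Proof.
move=> mS; elim: n => [|n IHn] injc cS ec.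
  by rewrite [segment _ _ _](_ : _ = set0) ?setU0 //; apply/setP => z; rewrite !inE.
have mIH : matchable (S :|: segment c lo n.*2).
  apply: IHn => [k k'|k|k]; rewrite ?inE => *;
    [apply: injc => //; rewrite inE|apply: cS|apply: ec]; lia.
have fresh k : lo + n.*2 <= k < lo + n.+1.*2 -> c k \notin S :|: segment c lo n.*2.
  move=> kP; rewrite inE negb_or cS /=; last by lia.
  apply/segmentP => -[k' k'P Ec].
  have Ek : k = k' by apply: injc; rewrite ?inE //; lia.
  by lia.
rewrite doubleS !segmentSr setUA [S :|: _]setUC -setUA [S :|: _]setUCA setUA.
apply: matchableU2 => //.
- by apply: fresh; lia.
- by apply: fresh; lia.
by rewrite e_sym addnS; apply: ec; lia.
Qed.

(* If no neighbour of v lies outside S, then S already dominates all that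
   v dominates. *)
Lemma paired_dominating_add S v :
  matchable S -> v \notin S -> dominating e (v |: S) ->
  paired_dominating e S \/
  exists w, paired_dominating e ([set v; w] :|: S).
Proof.
move=> mS vS domS.
case: (pickP [pred w | e v w & w \notin S]) => [w /andP[evw wS]|noW].
  right; exists w; split; last exact: matchableU2.
  move=> z; rewrite -setUA [_ :|: S]setUC setUA !inE negb_or -in_setU1.
  by case/andP=> /domS[u uS ezu] _; exists u; rewrite // inE uS.
have Nv u : e v u -> u \in S by move=> evu; have := noW u; rewrite /= evu; case: (u \in S).
left; split=> // z zS; have [->|zv] := eqVneq z v.
  by have [u evu] := e_noiso v; exists u => //; apply: Nv.
have /domS[u] : z \notin v |: S by rewrite !inE negb_or zv.
by rewrite in_setU1 => /predU1P[->|uS] ezu; [move: zS; rewrite Nv // e_sym|exists u].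
Qed.

(** A boolean form, as required by [arg_minnP] and [arg_maxnP]. *)
Definition paired_dominatingb D :=
  [forall v, (v \notin D) ==> [exists u in D, e v u]] &&
  [exists M : {set {set T}}, partition M D &&
     [forall B in M, exists u, exists v, e u v && (B == [set u; v])]].

Lemma paired_dominatingP D :
  reflect (paired_dominating e D) (paired_dominatingb D).
Proof.
apply: (iffP andP) => -[domD matD]; split.
- by move=> v vD; have /forallP/(_ v)/implyP/(_ vD)/exists_inP := domD.
- case/existsP: matD => M /andP[pM /forall_inP eM]; exists M; split=> // B /eM.
  by case/existsP=> u /existsP[v /andP[euv /eqP->]]; exists u, v.
- by apply/forallP => v; apply/implyP => /domD[u uD evu]; apply/exists_inP; exists u.
case: matD => M [pM eM]; apply/existsP; exists M; rewrite pM.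
apply/forall_inP => B /eM[u [v [euv ->]]].
by apply/existsP; exists u; apply/existsP; exists v; rewrite euv eqxx.
Qed.

(** A matchable set that is not dominating grows by an undominated vertex together with any
    neighbour of it; this must stop, since [T] is finite. *)
Lemma paired_dominating_ex : exists D, paired_dominating e D.
Proof.
suff grow n : (exists D, paired_dominating e D) \/
    exists2 D, matchable D & n <= #|D|.
  by have [//|[D _]] := grow #|T|.+1; rewrite ltnNge max_card.
elim: n => [|n [[D pD]|[D mD leD]]].
- by right; exists set0 => //; apply: matchable0.
- by left; exists D.
case dD: [forall v, (v \notin D) ==> [exists u in D, e v u]].
  left; exists D; split=> // v vD.
  by have /forallP/(_ v)/implyP/(_ vD)/exists_inP := dD.
move/negbT: dD; rewrite negb_forall => /existsP[v]; rewrite negb_imply => /andP[vD].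
rewrite negb_exists_in => /forall_inP noD; have [u evu] := e_noiso v.
have uD : u \notin D by apply: contraTN evu => /noD.
right; exists ([set v; u] :|: D); first exact: matchableU2.
rewrite -setUA cardsU1 !inE negb_or vD andbT.
have vu : v != u by apply: contraTneq evu => ->; rewrite e_irr.
rewrite vu cardsU1 uD; lia.
Qed.

Lemma min_paired_dominating_max (P : {set T}) :
  exists2 D, min_paired_dominating e D &
    forall D', paired_dominating e D' -> #|D'| <= #|D| ->
      #|D' :&: P| <= #|D :&: P|.
Proof.
have [D0 /paired_dominatingP pD0] := paired_dominating_ex.
case: (arg_minnP (fun D : {set T} => #|D|) pD0) => D1 pD1 minD1.
pose Q D := paired_dominatingb D && (#|D| <= #|D1|).
have QD1 : Q D1 by rewrite /Q pD1 leqnn.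
case: (arg_maxnP (fun D : {set T} => #|D :&: P|) QD1) => D /andP[pD leD] maxD.
exists D; first split; first exact/paired_dominatingP.
  by move=> D' /paired_dominatingP/minD1; apply: leq_trans.
move=> D' /paired_dominatingP pD' leD'.
by apply: maxD; rewrite /Q pD' (leq_trans leD').
Qed.

End Matching.

(** * Distance levels and the dominating shortest path *)

Lemma last_map_iota (T : Type) (c : nat -> T) m n :
  last (c m) (map c (iota m.+1 n)) = c (m + n).
Proof. by elim: n m => [|n IHn] m /=; rewrite ?addn0 // IHn addSnnS. Qed.

Lemma path_map_iota (T : Type) (e : rel T) (c : nat -> T) m n :
  (forall k, m <= k < m + n -> e (c k) (c k.+1)) ->
  path e (c m) (map c (iota m.+1 n)).
Proof.
elim: n m => //= n IHn m ec; rewrite ec ?IHn //=; last by lia.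
by move=> k kP; apply: ec; lia.
Qed.

Section Distance.
Variables (T : finType) (e : rel T) (x : T).
Hypotheses (e_sym : symmetric e) (e_conn : connected_graph e).
Implicit Types (t u v w z : T).

Local Notation dist := (gdist e x).

Lemma gdist_root : dist x = 0.
Proof.
have [_ /(_ [::])] := gdist_shortest (e_conn x x).
by rewrite leqn0 => /(_ _)/eqP; apply; rewrite /gpath /= eqxx.
Qed.

Lemma gdist_eq0 w : dist w = 0 -> w = x.
Proof.
by have [[p /and3P[_ /eqP <- _] <-] _] := gdist_shortest (e_conn x w) => /size0nil->.
Qed.

Lemma gdist_path_le u p : path e x p -> u \in x :: p -> dist u <= size p.
Proof.
move=> + up; case/splitPl: up => p1 p2 <-.
rewrite cat_path size_cat => /andP[/shortenP[q eq uq sub] _].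
have le_q := uniq_leq_size (subseq_uniq (subseq_cons _ _) uq) sub.
have [_ /(_ q)] := gdist_shortest (e_conn x (last x q)).
rewrite /gpath eq eqxx uq => /(_ isT) h.
exact: leq_trans (leq_trans h le_q) (leq_addr _ _).
Qed.

Lemma gdist_edge u v : e u v -> dist v <= (dist u).+1.
Proof.
have [[p /and3P[ep /eqP lp _] <-] _] := gdist_shortest (e_conn x u) => euv.
rewrite -(size_rcons p v); apply: gdist_path_le; first by rewrite rcons_path ep lp.
by rewrite inE mem_rcons mem_head orbT.
Qed.

Definition parents w := [set u | e u w & (dist u).+1 == dist w].

Lemma parents_ex w k : dist w = k.+1 -> exists u, u \in parents w.
Proof.
have [[p /and3P[+ /eqP + _] sp] _] := gdist_shortest (e_conn x w).
move=> + + dw; rewrite dw in sp; case/lastP: p sp => [//|p v].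
rewrite rcons_path last_rcons size_rcons => -[sp] /andP[ep ev] Ev.
subst v; exists (last x p); rewrite inE ev /=.
have := gdist_edge ev; rewrite dw eqSS ltnS eqn_leq => ->.
by rewrite andbT -sp gdist_path_le // mem_last.
Qed.

Lemma shortest_path_lt u : exists2 p, gpath e x u p &
  forall z, z \in x :: p -> z != u -> dist z < dist u.
Proof.
have [[p gp sp] _] := gdist_shortest (e_conn x u).
exists p => // z zp; move: gp; rewrite -sp => /and3P[].
case/splitPl: zp => p1 p2 <-; rewrite cat_path last_cat size_cat => /andP[ep1 _].
case: p2 => [|v p2]; first by move=> /= ->.
move=> _ _ _; apply: leq_ltn_trans (gdist_path_le ep1 (mem_last _ _)) _.
by rewrite /= addnS ltnS leq_addr.
Qed.

(** Follow a shortest path from [x] to [u], then step to [w]. Vertices before [u] lie at least two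
    levels below [z], so they are neither equal nor adjacent to it. *)
Lemma linked_avoiding_parent u w z : u \in parents w ->
  dist z = dist w -> z != w -> ~~ e z w -> ~~ e z u -> linked_avoiding e x w z.
Proof.
rewrite inE => /andP[euw /eqP dw] dz zw nezw nezu.
have [p /and3P[ep /eqP lp up] ltp] := shortest_path_lt u.
have lep v : v \in x :: p -> dist v <= dist u.
  by move=> vp; have [->//|vu] := eqVneq v u; apply/ltnW/ltp.
exists (rcons p w).
  rewrite /gpath rcons_path ep lp euw last_rcons eqxx -rcons_cons
    rcons_uniq up !andTb andbT.
  by apply/negP => wp; have := lep _ wp; rewrite -dw ltnn.
move=> v; rewrite -rcons_cons mem_rcons in_cons => /predU1P[->|vp].
  by rewrite inE negb_or eq_sym zw.
have [->|vu] := eqVneq v u.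
  by rewrite inE negb_or nezu andbT; apply: contraTneq isT => uz; rewrite uz in dw; lia.
have ltv := ltp _ vp vu; rewrite inE negb_or; apply/andP; split.
  by apply: contraTneq isT => vz; rewrite vz in ltv; lia.
by apply/negP; rewrite e_sym => /gdist_edge; lia.
Qed.

(* Otherwise x, w and z form an asteroidal triple. *)
Lemma parents_proper w z t (e_ATfree : AT_free e) :
  1 < dist w -> dist z = dist w -> z != w -> ~~ e z w ->
  e w t -> e z t -> dist t = (dist w).+1 ->
  (exists2 u, u \in parents w & ~~ e z u) -> #|parents z| < #|parents w|.
Proof.
move=> dw dz zw nezw ewt ezt dt [u uw nezu].
have linkw := linked_avoiding_parent uw dz zw nezw nezu.
have nbx v : v \in closed_nbhd e x -> dist v <= 1.
  rewrite inE => /predU1P[->|/gdist_edge]; by rewrite gdist_root.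
(* The path [w], [t], [z] stays at levels at least 2, away from [x] and its neighbours. *)
have linkwz : linked_avoiding e w z x.
  exists [:: t; z].
    have neq_t v : dist v = dist w -> v != t.
      by move=> dv; apply: contraTneq isT => vt; rewrite -vt in dt; lia.
    by rewrite /gpath /= ewt e_sym ezt eqxx !inE negb_or [w == z]eq_sym zw
      [t == z]eq_sym !neq_t.
  by move=> v; rewrite !in_cons orbF => /or3P[] /eqP->; apply/negP => /nbx; lia.
apply/proper_card/properP; split; last first.
  by exists u => //; rewrite inE negb_and e_sym nezu.
(* A parent [u'] of [z] not adjacent to [w] would give the last missing path, from [x] to [z]
   avoiding [w]. *)
apply/subsetP => u' u'z; rewrite inE.
have /andP[eu'z /eqP du'] : e u' z && ((dist u').+1 == dist z) by rewrite inE in u'z.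
rewrite du' dz eqxx andbT; apply/negPn/negP => neu'w.
have linkz : linked_avoiding e x z w.
  by apply: (linked_avoiding_parent u'z); rewrite // 1?eq_sym // 1?e_sym.
have xnw v : dist v = dist w -> x != v /\ ~~ e x v.
  move=> dv; split; first by apply: contraTneq isT => xv; rewrite -xv gdist_root in dv; lia.
  by apply/negP => exv; have := nbx v; rewrite inE exv orbT => /(_ isT); lia.
have [[xw nexw] [xz nexz]] := (xnw w erefl, xnw z dz).
have newz : ~~ e w z by rewrite e_sym.
apply: (e_ATfree x w z); split=> //.
by rewrite /= !inE negb_or xw xz eq_sym zw.
Qed.

Lemma greedy_geodesic y : exists c : nat -> T,
  [/\ c (dist y) = y,
      forall k, k <= dist y -> dist (c k) = k,
      forall k, k < dist y -> e (c k) (c k.+1) &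
      forall k w, k < dist y -> w \in parents (c k.+1) ->
        #|parents (c k)| <= #|parents w| ].
Proof.
move dy: (dist y) => n; elim: n => [|n IHn] in y dy *.
  by exists (fun=> y); split=> // k; rewrite leqn0 => /eqP->.
have [s0 s0y] := parents_ex dy.
case: (@arg_minnP T s0 [in parents y] (fun s => #|parents s|) s0y) => s sy mins.
have /andP[esy /eqP ds] : e s y && ((dist s).+1 == dist y) by move: sy; rewrite !inE.
have {}ds : dist s = n by lia.
have [c [cn dc ec minc]] := IHn s ds.
exists (fun k => if k <= n then c k else y); split=> [|k kn|k|k w].
- by rewrite ltnn.
- by case: ifP => [/dc//|]; lia.
- rewrite ltnS => kn; rewrite kn; case: ltnP => [/ec//|nk].
  by have -> : k = n by [lia]; rewrite cn.
rewrite ltnS => kn; rewrite kn; case: ltnP => [kn'|nk]; first exact: minc.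
by have -> : k = n by [lia]; rewrite cn; apply: mins.
Qed.

Lemma geodesic_spine y : AT_free e -> dominating_pair e x y ->
  exists c : nat -> T,
  [/\ forall k, k <= dist y -> dist (c k) = k,
      forall k, k < dist y -> e (c k) (c k.+1) &
      forall z, exists2 k, (k <= dist y) && (dist z <= k.+1 <= (dist z).+1) &
        (z == c k) || e z (c k)].
Proof.
move=> e_ATfree xy_dom; have [c [cy dc ec minc]] := greedy_geodesic y.
exists c; split=> // z; move: (dist y) cy dc ec minc => d cy dc ec minc.
have c0 : c 0 = x by apply/gdist_eq0/dc.
have gc : gpath e x y (map c (iota 1 d)).
  have injc : {in iota 0 d.+1 &, injective c}.
    move=> k k'; rewrite !mem_iota => kP k'P Ec.
    by rewrite -(dc k) ?Ec ?dc //; lia.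
  rewrite -c0 /gpath last_map_iota add0n cy eqxx path_map_iota //=.
  by have := map_inj_in_uniq injc; rewrite iota_uniq.
have [k kd zk] : exists2 k, k <= d & (z == c k) || e z (c k).
  case zc : (z \in [set z in x :: map c (iota 1 d)]).
    move: zc; rewrite inE -c0 -[_ :: _]/(map c (iota 0 d.+1)) => /mapP[k].
    by rewrite mem_iota => kP ->; exists k; rewrite ?eqxx //; lia.
  have [u] := xy_dom _ gc _ (negbT zc).
  rewrite inE -c0 -[_ :: _]/(map c (iota 0 d.+1)) => /mapP[k].
  by rewrite mem_iota => kP -> ezk; exists k; rewrite ?ezk ?orbT //; lia.
have dk : dist z <= k.+1 /\ k <= (dist z).+1.
  case/predU1P: zk => [->|ezk]; first by rewrite dc //; lia.
  have := gdist_edge ezk; rewrite e_sym in ezk; have := gdist_edge ezk.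
  by rewrite dc //; lia.
have [lek|ltk] := leqP k (dist z); first by exists k => //; lia.
(* Only the case where [z] is dominated from one level above remains. *)
have {dk ltk} Ek : k = (dist z).+1 by lia.
move Em: (dist z) Ek => m Ek; subst k.
have {zk} ezt : e z (c m.+1).
  by case/predU1P: zk => // Ez; move: Em; rewrite Ez dc //; lia.
have [Ez|zm] := eqVneq z (c m); first by exists m; rewrite ?Ez ?eqxx //; lia.
have [ezm|nezm] := boolP (e z (c m)); first by exists m; rewrite ?ezm ?orbT //; lia.
(* Levels 0 and 1 are settled by [c 0 = x]; [parents_proper] needs level at least 2. *)
case: m => [|m] in Em kd ezt zm nezm *.
  by move: zm; rewrite (gdist_eq0 Em) c0 eqxx.
have [ezm1|nezm1] := boolP (e z (c m)); first by exists m; rewrite ?ezm1 ?orbT //; lia.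
case: m => [|m] in Em kd ezt zm nezm nezm1 *.
  have [u] := parents_ex Em; rewrite inE Em => /andP[euz /eqP[/gdist_eq0 Eu]].
  by move: nezm1; rewrite c0 -Eu e_sym euz.
have dcm : dist (c m.+2) = m.+2 by apply: dc; lia.
(* Both [z] and [c m.+2] are parents of [c m.+3], and the latter was chosen with fewest parents. *)
suff : #|parents z| < #|parents (c m.+2)|.
  by rewrite ltnNge minc // inE ezt Em dc //=.
apply: (parents_proper (t := c m.+3)) => //; rewrite ?dcm ?dc //; first exact: ec.
by exists (c m.+1); rewrite // inE ec ?dcm ?dc //=; lia.
Qed.

End Distance.

(** * Counting vertices in windows of consecutive levels *)

Lemma bigcup_levels (T : finType) (e : rel T) x i j :
  \bigcup_(i <= k < (i + j).+1) level e x k = [set w | i <= gdist e x w <= i + j].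
Proof.
apply/setP => w; rewrite inE.
rewrite (big_morph (fun A : {set T} => w \in A) (id1 := false) (op1 := orb));
  [|by move=> A B; rewrite inE|by rewrite inE].
rewrite big_has; apply/hasP/idP => [[k]|wP].
  by rewrite mem_index_iota inE ltnS => kP /eqP->.
by exists (gdist e x w); rewrite ?mem_index_iota ?inE ?ltnS.
Qed.

Section Window.
Variables (T : finType) (e : rel T) (x : T) (c : nat -> T) (d : nat).
Hypotheses (e_sym : symmetric e) (e_conn : connected_graph e)
  (e_noiso : no_isolated e).
Local Notation dist := (gdist e x).
Hypotheses (dist_c : forall k, k <= d -> dist (c k) = k)
  (edge_c : forall k, k < d -> e (c k) (c k.+1))
  (spine_c : forall z, exists2 k, (k <= d) && (dist z <= k.+1 <= (dist z).+1) &
     (z == c k) || e z (c k)).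
Variable D : {set T}.
Local Notation P := (segment c 0 d.+1).
Hypotheses (minD : min_paired_dominating e D)
  (maxD : forall D', paired_dominating e D' -> #|D'| <= #|D| ->
     #|D' :&: P| <= #|D :&: P|).

Let U i j := [set w | i <= dist w <= i + j].

Lemma c_inj k k' : k <= d -> k' <= d -> c k = c k' -> k = k'.
Proof. by move=> kd k'd Ec; rewrite -(dist_c kd) Ec dist_c. Qed.

(** The exchange argument. Writing [(dist w).+1 <> i] makes the lower gap condition vacuous for
    [i = 0], where [i - 1] would truncate to level 0. *)
Lemma window_isolated_bound i j :
  (forall w, w \in D -> (dist w).+1 <> i /\ dist w <> (i + j).+1) ->
  #|D :&: U i j| <= j + 4.
Proof.
move=> gap; rewrite leqNgt; apply/negP => bad.
have [[domD mD] leD] := minD.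
pose D0 := D :\: U i j.
have inD0 w : (w \in D0) = ~~ (i <= dist w <= i + j) && (w \in D) by rewrite !inE.
have cardD0 : #|D :&: U i j| + #|D0| = #|D| by rewrite cardsID.
have mD0 : matchable e D0.
  have -> : D0 = D :\: (D :&: U i j) by rewrite setDIr setDv set0U.
  (* An edge changes the level by at most one, so it cannot cross an empty level. *)
  apply: (matchableD e_sym mD) => u v euv.
  rewrite !inE => /andP[_ uU] vD; rewrite vD /=.
  have := gap v vD; have := gdist_edge x e_conn euv.
  by rewrite e_sym in euv; have := gdist_edge x e_conn euv; lia.
pose m := minn (i + j).+1 d.
(* When c (i - 2) is kept in D0, with its partner, the path starts after it.
   For i < 2, i - 2 is 0. *)
pose lo := if c (i - 2) \in D0 then (i - 2).+1 else i - 2.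
pose n := m.+1 - lo.
have lo_ge : i - 2 <= lo <= (i - 2).+1 by rewrite /lo; case: ifP; lia.
have range k : lo <= k < lo + n -> [/\ k <= d, k <= (i + j).+1 & i - 2 <= k].
  by rewrite /n /m => kP; split; lia.
have n_le : n <= j + 4 by rewrite /n /m; lia.
have fresh k : lo <= k < lo + n -> c k \notin D0.
  move=> kP; have [kd kij ik] := range k kP; rewrite inD0 dist_c //.
  apply/negP => /andP[kU ckD]; have := gap _ ckD; rewrite dist_c // => -[ki kj].
  have Ek : k = i - 2 by lia.
  have : c k \in D0 by rewrite inD0 dist_c // kU.
  by move: kP; rewrite Ek /lo => + cD0; rewrite cD0; lia.
have inj_c : {in [pred k | lo <= k < lo + n] &, injective c}.
  by move=> k k'; rewrite !inE => /range[kd _ _] /range[k'd _ _]; apply: c_inj.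
have domB : dominating e (D0 :|: segment c lo n).
  move=> z; rewrite inE negb_or => /andP[zD0 zB].
  (* Only vertices in the window or on the two levels beside it can lose their dominator. *)
  have [zU|[u uD0 ezu]] : i <= (dist z).+1 /\ dist z <= (i + j).+1 \/
      exists2 u, u \in D0 & e z u.
    case zD : (z \in D); first by left; move: zD0; rewrite inD0 zD andbT; lia.
    have [u uD ezu] := domD z (negbT zD).
    have [uU|uU] := boolP (i <= dist u <= i + j); last by right; exists u; rewrite ?inD0 ?uU.
    left; have := gdist_edge x e_conn ezu.
    by rewrite e_sym in ezu; have := gdist_edge x e_conn ezu; lia.
  - have [k /andP[kd zk] ezk] := spine_c z.
    have ckB : c k \in D0 :|: segment c lo n.
      rewrite inE orbC; case: segmentP => //= noB.
      have [lok|lok] := leqP lo k.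
        by case: noB; exists k => //; rewrite /n /m; lia.
      (* The only index that [lo] may skip; then [c k] was kept in [D0]. *)
      have Ek : k = i - 2 by lia.
      by move: lok; rewrite Ek /lo; case: ifP => //; lia.
    exists (c k) => //; case/predU1P: ezk => // Ez.
    by move: ckB; rewrite -Ez inE (negbTE zD0) (negbTE zB).
  by exists u; rewrite // inE uD0.
have n2 := odd_double_half n.
have mS n' : n'.*2 <= n -> matchable e (D0 :|: segment c lo n'.*2).
  move=> n'n; apply: matchable_segment => // [k k'|k kP|k lok kn].
  - by rewrite !inE => kP k'P; apply: inj_c; rewrite inE; lia.
  - by apply: fresh; lia.
  by apply: edge_c; have [] := range k.+1; lia.
have cardS n' : #|D0 :|: segment c lo n'| <= #|D0| + n'.
  by rewrite (leq_trans (leq_card_setU _ _)) // leq_add2l card_segment_le.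
have small D' : paired_dominating e D' -> #|D'| <= #|D0| + n -> False.
  by move=> /leD; lia.
case odd_n : (odd n) n2 => /= n2; last first.
  apply: (small (D0 :|: segment c lo n)) => //; split=> //.
  by rewrite -n2; apply: mS; lia.
(* For odd [n] the last vertex [v] of the segment is left without a partner. *)
pose v := c (lo + n./2.*2); pose S := D0 :|: segment c lo n./2.*2.
have vS : v |: S = D0 :|: segment c lo n by rewrite -n2 add1n segmentSr setUCA.
have v_notin : v \notin S.
  rewrite inE negb_or fresh; last by lia.
  apply/segmentP => -[k kP Ev].
  have Ek : lo + n./2.*2 = k by apply: inj_c; rewrite ?inE //; lia.
  by lia.
have := paired_dominating_add e_sym e_noiso (mS _ _) v_notin.
rewrite vS => /(_ _ domB)[|pS|[w pD']]; first by lia.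
  by apply: (small S) => //; have := cardS n./2.*2; rewrite -/S; lia.
pose D' := [set v; w] :|: S; have D'E : D' = w |: (D0 :|: segment c lo n).
  by rewrite -vS /D' setUCA setUA.
have cardD' : #|D'| <= #|D0| + n.+1.
  rewrite D'E cardsU1; have := cardS n; case: (w \notin _); lia.
have leDD' : #|D| <= #|D'| := leD _ pD'.
have leP : #|D' :&: P| <= #|D :&: P| by apply: maxD => //; rewrite -/D'; lia.
(* Minimality of [D] leaves no slack: [D'] has at most [#|D0| + n.+1] vertices, while [D] has at
   least [#|D0| + j + 5]. *)
have n_eq : n = j + 4 by lia.
have BP : segment c lo n \subset P.
  apply/subsetP => z /segmentP[k /range[kd _ _] ->].
  by apply/segmentP; exists k => //; lia.
have cardB : #|segment c lo n| = n.
  rewrite cardsE -[RHS](size_iota lo) -(size_map c); apply/card_uniqP.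
  rewrite map_inj_in_uniq ?iota_uniq // => k k'.
  by rewrite !mem_iota; apply: inj_c.
have lower : #|D0 :&: P| + n <= #|D' :&: P|.
  have disj : [disjoint D0 :&: P & segment c lo n].
    rewrite disjoint_sym disjoints_subset; apply/subsetP => z /segmentP[k kP ->].
    by rewrite in_setC in_setI negb_and fresh.
  rewrite -{1}cardB -cardsUI; move: disj; rewrite -setI_eq0 => /eqP->.
  rewrite cards0 addn0 subset_leq_card // D'E.
  apply/subsetP => z /setUP[/setIP[zD0 zP]|zB]; rewrite in_setI.
    by rewrite zP !in_setU zD0 orbT.
  by rewrite (subsetP BP) // !in_setU zB !orbT.
(* The path has at most one vertex on each of the [j.+1] removed levels, whereas [D'] gains [j + 4]
   path vertices over [D0]. *)
have upper : #|D :&: P| <= #|D0 :&: P| + j.+1.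
  rewrite -(cardsID (U i j) (D :&: P)) addnC setIDAC leq_add2l.
  apply: leq_trans (card_segment_le c i j.+1); apply/subset_leq_card/subsetP => z.
  rewrite -setIA => /setIP[_ /setIP[/segmentP[k kP ->]]]; rewrite inE dist_c; last by lia.
  by move=> kU; apply/segmentP; exists k => //; lia.
by lia.
Qed.

(** A vertex of [D] on a level beside a violating window lets the window grow by that level and
    still violate the bound, so induction on [#|D| - j] reduces to isolated windows. *)
Lemma window_bound i j : #|D :&: U i j| <= j + 4.
Proof.
have [n] := ubnP (#|D| - j); elim: n => // n IHn in i j *; rewrite ltnS => le_n.
rewrite leqNgt; apply/negP => bad; have := bad; rewrite ltnNge => /negP; apply.
apply: window_isolated_bound => w wD.
(* This makes the truncated difference [#|D| - j] strictly decrease. *)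
have small : j + 4 < #|D| by apply: leq_trans bad (subset_leq_card (subsetIl _ _)).
have wide i' : w \in U i' j.+1 :\: U i j -> U i j \subset U i' j.+1 -> False.
  move=> /setDP[wU' wU] sub; have : #|D :&: U i' j.+1| <= j.+1 + 4 by apply: IHn; lia.
  apply/negP; rewrite -ltnNge.
  have : w |: (D :&: U i j) \subset D :&: U i' j.+1.
    by rewrite subUset sub1set inE wD wU' setIS.
  by move/subset_leq_card; rewrite cardsU1 inE wD (negbTE wU); lia.
split=> dw.
- apply: (wide (dist w)); first by rewrite !inE; lia.
  by apply/subsetP => z; rewrite !inE; lia.
apply: (wide i); first by rewrite !inE; lia.
by apply/subsetP => z; rewrite !inE; lia.
Qed.

End Window.

Theorem theorem4 (T : finType) (e : rel T)
    (e_sym : symmetric e) (e_irr : irreflexive e)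
    (e_conn : connected_graph e) (e_noiso : no_isolated e)
    (e_ATfree : AT_free e)
    (x y : T) (xy_dom : dominating_pair e x y) :
  exists Dp : {set T},
    min_paired_dominating e Dp /\
    forall i j : nat, i <= ecc e x -> j <= ecc e x - i ->
      #|Dp :&: \bigcup_(i <= k < (i + j).+1) level e x k| <= j + 4.
Proof.
have [c [dist_c edge_c spine_c]] := geodesic_spine e_sym e_conn e_ATfree xy_dom.
have [D minD maxD] := min_paired_dominating_max e_irr e_noiso
  (segment c 0 (gdist e x y).+1).
exists D; split=> // i j _ _; rewrite bigcup_levels.
exact: (window_bound e_sym e_conn e_noiso dist_c edge_c spine_c minD maxD).
Qed.
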